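(* PAV and RAV do not satisfy simple justified representation for $k\ge 3$ and $d\ge 2$, or for $d\ge 3$ and $k\ge 2$. For $k\le 2$ and $d\le 2$, PAV and RAV satisfy simple justified representation.
   Context: Attribute-approval committee selection: there is a set of voters $V=\{v_1,\dots,v_n\}$, a set of candidates $C=\{c_1,\dots,c_m\}$, a number of dimensions $d$, and a target committee size $k$. Each candidate $c$ has a $d$-dimensional vector of attribute values $(c[1],\dots,c[d])$, with $c[j]$ from a domain $D^j$. Each voter $v_i$ submits, for every $j\in\{1,\dots,d\}$, the set $C_i^j\subseteq D^j$ of values that $v_i$ approves. A committee is a set $W\subseteq C$ of $k$ candidates, and $W^j$ denotes the set of attributes of $W$ on dimension $j$. For $X\subseteq C$ and a voter $v_i$, put $AV(X,v_i)=\sum_{c\in X}\frac{|\{j: c[j]\in C_i^j\}|}{d}$. - RAV starts with $W=\emptyset$ and at every stage adds to $W$ a candidate $c$ maximizing $\sum_{v_i\in V}\frac{1}{1+AV(W,v_i)}\cdot\frac{|\{j: c[j]\in C_i^j\}|}{d}$, until $|W|=k$. - PAV selects a committee $W$ of size $k$ maximizing $\sum_{v_i\in V}u(AV(W,v_i))$, where $u(p)=1+\frac12+\dots+\frac{1}{\lfloor p\rfloor}+\frac{1}{\lceil p\rceil}(p-\lfloor p\rfloor)$ (the last term being $0$ when $p$ is an integer). Simple justified representation (SJR) of a committee $W$: for every $V'\subseteq V$ with $|V'|\ge \frac nk$ such that $\bigcap_{v_i\in V'}C_i^j\neq\emptyset$ for some $j\in\{1,\dots,d\}$, there is $j'\in\{1,\dots,d\}$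 with $\left(\bigcup_{v_i\in V'}C_i^{j'}\right)\cap W^{j'}\ne\emptyset$. A rule satisfies SJR if the committee it selects always satisfies it.
   Formalization: Each domain D^j is taken to consist of values that some candidate has (else SJR can be unattainable), and for k = d = 2 only some way of breaking ties is claimed to satisfy SJR, as a tied PAV or RAV committee can violate it; for other k, d ≤ 2 every tie-breaking does. *)

(* Defs.v *)
From HB Require Import structures.
From mathcomp Require Import all_boot all_order all_algebra.
Set Implicit Arguments.
Unset Strict Implicit.
Unset Printing Implicit Defensive.
Import Order.TTheory GRing.Theory Num.Theory.
Local Open Scope ring_scope.

(* [dom_attained] says that D^j consists of the values occurring among the
   candidates. Otherwise the voters could all approve of only a value that no
   candidate has, and then no committee whatsoever would satisfy SJR. *)
Record election (d : nat) := Election {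
  voter : finType;
  cand : finType;
  dom : 'I_d -> finType;
  attr : cand -> forall j : 'I_d, dom j;
  appr : voter -> forall j : 'I_d, {set dom j};
  voter_gt0 : (0 < #|voter|)%N;
  dom_attained : forall (j : 'I_d) (x : dom j), exists c : cand, attr c j = x
}.

Section Election.
Variables (d : nat) (E : election d).
Implicit Types (W X : {set cand E}) (c : cand E) (v : voter E).

Definition share c v : rat :=
  #|[set j : 'I_d | attr c j \in appr v j]|%:R / d%:R.

Definition AV X v : rat := \sum_(c in X) share c v.

Definition RAV_score W c : rat :=
  \sum_(v : voter E) 1 / (1 + AV W v) * share c v.

Inductive RAV_stage : {set cand E} -> Prop :=
| RAV_start : RAV_stage set0
| RAV_add W c : RAV_stage W -> c \notin W ->
    (forall c', c' \notin W -> RAV_score W c' <= RAV_score W c) ->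
    RAV_stage (c |: W).

Definition RAV_committee (k : nat) W : Prop := RAV_stage W /\ #|W| = k.

(* For an integer p the last term is 0, also at p = 0, as x / 0 = 0. *)
Definition PAV_utility (p : rat) : rat :=
  \sum_(1 <= i < (Num.truncn p).+1) 1 / i%:R
    + 1 / (Num.ceil p)%:~R * (p - (Num.floor p)%:~R).

Definition PAV_score W : rat := \sum_(v : voter E) PAV_utility (AV W v).

Definition PAV_committee (k : nat) W : Prop :=
  #|W| = k /\ forall W', #|W'| = k -> PAV_score W' <= PAV_score W.

Definition SJR (k : nat) W : Prop :=
  forall V' : {set voter E},
    #|voter E|%:R / k%:R <= #|V'|%:R :> rat ->
    (exists j : 'I_d, \bigcap_(v in V') appr v j != set0) ->
    exists j : 'I_d,
      (\bigcup_(v in V') appr v j) :&: [set attr c j | c in W] != set0.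

End Election.

(* A rule is resolute: it selects one committee. A PAV or RAV rule is thus PAV
   or RAV together with an arbitrary way of breaking the ties. Only elections
   with at least k candidates are relevant. *)
Definition rule (d : nat) : Type := forall E : election d, {set cand E}.

Definition PAV_rule (k d : nat) (F : rule d) : Prop :=
  forall E : election d, (k <= #|cand E|)%N -> PAV_committee k (F E).

Definition RAV_rule (k d : nat) (F : rule d) : Prop :=
  forall E : election d, (k <= #|cand E|)%N -> RAV_committee k (F E).

Definition satisfies_SJR (k d : nat) (F : rule d) : Prop :=
  forall E : election d, (k <= #|cand E|)%N -> SJR k (F E).

(* Main.v *)
(* Negative part: k voters and candidates None, Some 0, ..., Some (k - 1). Voter
   v0 approves of None on a single dimension and of nothing else; each other
   voter fully approves of every Some i. Some i always contributes at least
   (k - 1) / k to the score and None only 1 / d, so that None is never selected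
   when k < (k - 1) d, and v0 alone (n / k = 1) violates SJR.

   Positive part for k = 2: let V' violate SJR for W = {c1, c2}, and let x have
   a value approved by all of V'. The optimality of c1 and c2 against x,
   averaged over the two choices and estimated voter by voter, gives
   |V'| / d <= |V \ V'| / 2, while |V \ V'| <= |V'|. Hence d = 2 and all the
   inequalities are equalities: {c1, x} is also a possible outcome. It satisfies
   SJR, since only V \ V' could violate it, and then c1 would be useless. *)
Require Import Defs.
From HB Require Import structures.
From mathcomp Require Import all_boot all_order all_algebra.
From mathcomp Require Import zify lra.
From Stdlib Require Import ClassicalEpsilon.
Set Implicit Arguments.
Unset Strict Implicit.
Unset Printing Implicit Defensive.
Import Order.TTheory GRing.Theory Num.Theory.

(** * The PAV utility as a piecewise linear function *)

Section Utility.
Local Open Scope ring_scope.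

Lemma PAV_utility_nat (m : nat) :
  PAV_utility m%:R = \sum_(1 <= i < m.+1) 1 / i%:R.
Proof.
by rewrite /PAV_utility natrK -[m%:R]/(m%:~R) intrKfloor subrr mulr0 addr0.
Qed.

(** The interval may be closed on the right: at p = m + 1 the fractional term has grown into the
    next harmonic term. *)
Lemma PAV_utility_frac (m : nat) (p : rat) :
  m%:R <= p <= m.+1%:R ->
  PAV_utility p = \sum_(1 <= i < m.+1) 1 / i%:R + (p - m%:R) / m.+1%:R.
Proof.
case/andP=> mp pm1.
have [->|p_ne_m] := eqVneq p m%:R.
  by rewrite PAV_utility_nat subrr mul0r addr0.
have [->|p_ne_m1] := eqVneq p m.+1%:R.
  rewrite PAV_utility_nat big_nat_recr //= -natrB // subSn // subnn.
  by [].
have mp' : m%:R < p by rewrite lt_neqAle eq_sym p_ne_m.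
have pm1' : p < m.+1%:R by rewrite lt_neqAle p_ne_m1.
have floorE : Num.floor p = m%:Z.
  by apply: floor_def; rewrite intrD -!pmulrn natr1 mp.
have ceilE : Num.ceil p = m.+1%:Z.
  by apply: ceil_def; rewrite intrB -!pmulrn -natr1 addrK natr1 mp'.
rewrite /PAV_utility floorE ceilE (@truncn_def _ _ m) ?mp //.
by rewrite mul1r mulrC.
Qed.

Lemma PAV_utility_le1 (p : rat) : 0 <= p <= 1 -> PAV_utility p = p.
Proof.
by move=> p01; rewrite (@PAV_utility_frac 0) // big_nil add0r subr0 divr1.
Qed.

Lemma PAV_utility_ge1 (p : rat) : 1 <= p <= 2 -> PAV_utility p = (1 + p) / 2.
Proof.
move=> p12; rewrite (@PAV_utility_frac 1) // big_nat1; lra.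
Qed.

Lemma PAV_utility_bounds (p : rat) :
  0 <= p <= 2 -> PAV_utility p = (if p <= 1 then p else (1 + p) / 2).
Proof.
case/andP=> p0 p2; have [p1|/ltW p1] := leP p 1.
- by rewrite PAV_utility_le1 ?p0.
- by rewrite PAV_utility_ge1 ?p1.
Qed.

End Utility.

(** * Shares, existence of outcomes, and violations of SJR *)

Section Election.
Local Open Scope ring_scope.
Variables (d : nat) (E : election d).
Implicit Types (W X : {set cand E}) (c x y : cand E) (v : voter E).

Lemma share_ge0 c v : 0 <= share c v.
Proof. by rewrite divr_ge0. Qed.

Lemma share_le1 c v : share c v <= 1.
Proof.
(* For d = 0 the share is 0, by the convention on division by zero. *)
case: d E c v => [|n] E0 c v; first by rewrite /share invr0 mulr0.
rewrite ler_pdivrMr ?ltr0n // mul1r ler_nat.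
by rewrite -[X in (_ <= X)%N]card_ord max_card.
Qed.

Lemma share_gt0P c v :
  reflect (exists j, attr c j \in appr v j) (0 < share c v).
Proof.
rewrite lt_neqAle share_ge0 andbT eq_sym mulf_eq0 invr_eq0 !pnatr_eq0 negb_or.
rewrite cards_eq0; apply: (iffP andP) => [[/set0Pn[j]]|[j vcj]].
  by rewrite inE => vcj _; exists j.
split; last by rewrite -lt0n (leq_ltn_trans _ (ltn_ord j)).
by apply/set0Pn; exists j; rewrite inE.
Qed.

Lemma AV0 v : AV set0 v = 0.
Proof. exact: big_set0. Qed.

Lemma AV1 c v : AV [set c] v = share c v.
Proof. exact: big_set1. Qed.

Lemma AVU1 c W v : c \notin W -> AV (c |: W) v = share c v + AV W v.
Proof. exact: big_setU1. Qed.

Lemma RAV_committee_exists k :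
  (k <= #|cand E|)%N -> exists W, RAV_committee k W.
Proof.
elim: k => [_|k IHk lt_k].
  by exists set0; split; [exact: RAV_start | exact: cards0].
have [W [stW Wk]] := IHk (ltnW lt_k).
have /card_gt0P[c0] : (0 < #|~: W|)%N by have := cardsC W; lia.
rewrite inE => c0W.
case: (Order.TotalTheory.arg_maxP (P := fun c => c \notin W)
  (RAV_score W) c0W) => c cW maxc.
exists (c |: W); split; first exact: RAV_add.
by rewrite cardsU1 cW Wk.
Qed.

Lemma PAV_committee_exists k :
  (k <= #|cand E|)%N -> exists W, PAV_committee k W.
Proof.
(* The RAV committee serves merely as some set of size k, so that the maximum exists. *)
move=> /RAV_committee_exists[W0 [_ /eqP W0k]].
case: (Order.TotalTheory.arg_maxP (P := fun W => #|W| == k)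
  (@PAV_score d E) W0k) => W /eqP Wk maxW.
by exists W; split=> // W' /eqP; apply: maxW.
Qed.

(* Every violation of SJR by [W] is of this form: [V'] is the violating group
   and [x] a candidate having a value that all of [V'] approve of. *)
Definition blocks (k : nat) W (V' : {set voter E}) x : bool :=
  [&& (#|voter E| <= #|V'| * k)%N,
      [forall v in V', d%:R^-1 <= share x v]
    & [forall c in W, [forall v in V', share c v == 0]]].

(** The converse fails in general: in [blocks] the voters may approve of different attributes of
    x. *)
Lemma SJR_of_not_blocks k W :
  (0 < k)%N -> (forall V' x, ~~ blocks k W V' x) -> SJR k W.
Proof.
move=> k_gt0 Wnb V' sizeV' [j /set0Pn[a /bigcapP Va]].
have [x xa] := dom_attained a.
have := Wnb V' x; rewrite -[~~ _]/(~~ (_ && _)) negb_and -implybE.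
move/implyP => nb.
have : (#|voter E| <= #|V'| * k)%N.
  by rewrite -(ler_nat rat) natrM -ler_pdivrMr // ltr0n.
move/nb; rewrite negb_and -implybE => /implyP => nb1.
have : [forall v in V', d%:R^-1 <= share x v].
  apply/forall_inP => v /Va vaj.
  rewrite -[leLHS]mul1r ler_wpM2r ?invr_ge0 // ler1n card_gt0.
  by apply/set0Pn; exists j; rewrite inE xa.
move/nb1; rewrite negb_forall_in => /exists_inP[c cW].
rewrite negb_forall_in => /exists_inP[v vV' cv].
have : 0 < share c v by rewrite lt_neqAle eq_sym cv share_ge0.
case/share_gt0P => i vci; exists i; apply/set0Pn; exists (attr c i).
rewrite inE; apply/andP; split; last exact: imset_f.
by apply/bigcupP; exists v.
Qed.

Lemma blocksP k W (V' : {set voter E}) x :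
  reflect [/\ (#|voter E| <= #|V'| * k)%N,
              {in V', forall v, d%:R^-1 <= share x v}
            & {in W & V', forall c v, share c v = 0}]
          (blocks k W V' x).
Proof.
apply: (iffP and3P) => -[nV' xV' WV']; split=> //.
- exact/forall_inP.
- by move=> c v cW vV'; move/forall_inP/(_ c cW)/forall_inP/(_ v vV')/eqP: WV'.
- exact/forall_inP.
- by apply/forall_inP => c cW; apply/forall_inP => v vV'; rewrite WV'.
Qed.

Hypothesis d_gt0 : (0 < d)%N.

Lemma blocks_gt0 k W (V' : {set voter E}) x : blocks k W V' x -> (0 < #|V'|)%N.
Proof.
case/blocksP => nV' _ _; rewrite lt0n; apply: contraL nV' => /eqP ->.
by rewrite mul0n -ltnNge voter_gt0.
Qed.

Lemma blocks_share_gt0 k W (V' : {set voter E}) x v :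
  blocks k W V' x -> v \in V' -> 0 < share x v.
Proof.
case/blocksP => _ xV' _ /xV'; apply: lt_le_trans.
by rewrite invr_gt0 ltr0n.
Qed.

Lemma blocks_notin k W (V' : {set voter E}) x : blocks k W V' x -> x \notin W.
Proof.
move=> bl; have /card_gt0P[v vV'] := blocks_gt0 bl.
have := blocks_share_gt0 bl vV'; apply: contraL => xW.
by case/blocksP: bl => _ _ ->; rewrite ?ltxx.
Qed.

Lemma SJR_swap W (V' : {set voter E}) x c v :
  blocks 2 W V' x -> (#|V'| * 2 = #|voter E|)%N -> c \in W -> 0 < share c v ->
  SJR 2 [set c; x].
Proof.
move=> bl V'half cW cv; apply: SJR_of_not_blocks => // V2 y.
apply/blocksP => -[nV2 _ zeroV2].
have disj u : u \in V2 -> u \notin V'.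
  move=> uV2; apply/negP => /(blocks_share_gt0 bl).
  by rewrite zeroV2 ?inE ?eqxx ?orbT ?ltxx.
have V2E : V2 = ~: V'.
  apply/eqP; rewrite eqEcard; apply/andP; split.
    by apply/subsetP => u /disj; rewrite inE.
  by have := cardsC V'; lia.
(* There is no place for v: members of W, such as c, have share 0 on V', and c has share 0 on V2,
   the complement. *)
have [vV'|vV'] := boolP (v \in V').
  by case/blocksP: bl cv => _ _ ->; rewrite ?ltxx.
by move: cv; rewrite zeroV2 ?ltxx ?inE ?eqxx // V2E inE.
Qed.

(** The sum is at most |V'| (1/2 - 1/d), which is nonpositive for d <= 2, so every estimate must be
    tight. F is left abstract to serve both PAV and RAV. *)
Lemma blocks_tie W (V' : {set voter E}) x (F : voter E -> rat) :
  (d <= 2)%N -> blocks 2 W V' x ->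
  {in V', forall v, F v <= - d%:R^-1} ->
  (forall v, v \notin V' -> F v <= 1 / 2) ->
  0 <= \sum_v F v ->
  [/\ d = 2, (#|V'| * 2 = #|voter E|)%N & \sum_v F v = 0].
Proof.
move=> d_le2 bl FV' FV'C F_ge0.
have V'_gt0 := blocks_gt0 bl.
have [nV' _ _] := blocksP _ _ _ _ bl.
have : \sum_v F v <= - #|V'|%:R / d%:R + #|~: V'|%:R / 2.
  rewrite (bigID (mem V')) /= lerD //.
    apply: le_trans (ler_sum _ FV') _.
    by rewrite sumr_const mulNr mulNrn mulr_natl.
  apply: le_trans (ler_sum _ FV'C) _.
  rewrite (eq_bigl (mem (~: V'))); last by move=> v; rewrite !inE.
  by rewrite sumr_const mul1r mulr_natl.
have V'C_le : #|~: V'|%:R <= #|V'|%:R :> rat.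
  by rewrite ler_nat; have := cardsC V'; lia.
have V'_gt0R : 0 < #|V'|%:R :> rat by rewrite ltr0n.
have [d1|d_ne1] := eqVneq d 1.
  by have -> : d%:R = 1 :> rat by [rewrite d1]; rewrite divr1; lra.
have d2 : d = 2 by lia.
have -> : d%:R = 2 :> rat by rewrite d2.
move=> F_le; split => //; last by lra.
have : #|~: V'|%:R = #|V'|%:R :> rat by lra.
by move/eqP; rewrite eqr_nat => /eqP V'CE; have := cardsC V'; lia.
Qed.

(** * PAV for d <= 2 and k <= 2 *)

Lemma AV2 c x v : c != x -> AV [set c; x] v = share c v + share x v.
Proof. by move=> cx; rewrite AVU1 ?inE // AV1. Qed.

Lemma PAV_swap W (V' : {set voter E}) x :
  (d <= 2)%N -> PAV_committee 2 W -> blocks 2 W V' x ->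
  d = 2 /\ exists W', PAV_committee 2 W' /\ SJR 2 W'.
Proof.
move=> d_le2 [/eqP /cards2P[c1 [c2 [c12 WE]]] maxW] bl.
have := blocks_notin bl; rewrite WE !inE negb_or => /andP[xc1 xc2].
rewrite eq_sym in xc1; rewrite eq_sym in xc2.
have [_ xV' WV'] := blocksP _ _ _ _ bl.
have c1V' v : v \in V' -> share c1 v = 0.
  by apply: WV'; rewrite WE !inE eqxx.
have c2V' v : v \in V' -> share c2 v = 0.
  by apply: WV'; rewrite WE !inE eqxx orbT.
have le1 := maxW [set c1; x]; rewrite cards2 xc1 in le1.
have le2 := maxW [set c2; x]; rewrite cards2 xc2 in le2.
have {le1} le1 := le1 erefl; have {le2} le2 := le2 erefl.
(* The loss of voter v, averaged over the two ways of exchanging a member of W for x. *)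
pose F v := PAV_utility (AV W v) - (PAV_utility (AV [set c1; x] v)
                                    + PAV_utility (AV [set c2; x] v)) / 2.
have FE : \sum_v F v
    = PAV_score W - (PAV_score [set c1; x] + PAV_score [set c2; x]) / 2.
  by rewrite /PAV_score -big_split mulr_suml -sumrB.
have [v vV'|v vV'||d2 V'half F0] := blocks_tie d_le2 bl (F := F).
- rewrite /F WE !AV2 // c1V' // c2V' // !add0r.
  have := xV' v vV'; have := share_le1 x v; have := share_ge0 x v.
  move=> *; rewrite !PAV_utility_le1 //; lra.
(* The worst case is a zero share of x. With s the total share of c1 and c2, the loss is then u(s) -
   s/2, which is s/2 for s <= 1 and exactly 1/2 from there on. *)
- rewrite /F WE !AV2 //.
  have := share_le1 x v; have := share_ge0 x v.
  have := share_le1 c1 v; have := share_ge0 c1 v.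
  have := share_le1 c2 v; have := share_ge0 c2 v.
  move=> *; rewrite !PAV_utility_bounds; try lra.
  by do 3!case: ifPn; rewrite -?ltNge => *; lra.
- rewrite FE; lra.
split=> //; have score1 : PAV_score [set c1; x] = PAV_score W by lra.
have score2 : PAV_score [set c2; x] = PAV_score W by lra.
exists [set c1; x]; split.
  by split=> [|W' W'2]; rewrite ?cards2 ?xc1 // score1 maxW.
(* Otherwise exchanging c1 for x would harm nobody and strictly help V', although {c2, x} only ties
   with W. *)
have [v c1v] : exists v, 0 < share c1 v.
  apply/existsP; apply: contraTT isT => /existsPn c1_0.
  have {}c1_0 v : share c1 v = 0.
    by apply/eqP; rewrite eq_le share_ge0 leNgt c1_0.
  have /card_gt0P[v vV'] := blocks_gt0 bl.
  pose G u := PAV_utility (AV [set c2; x] u) - PAV_utility (AV W u).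
  have GE : \sum_v G v = 0.
    by rewrite /G sumrB -[LHS]/(PAV_score _ - PAV_score _) score2 subrr.
  have G_ge0 u : true -> 0 <= G u.
    rewrite /G WE !AV2 // c1_0 add0r => _.
    have := share_le1 x u; have := share_ge0 x u.
    have := share_le1 c2 u; have := share_ge0 c2 u.
    move=> *; rewrite !PAV_utility_bounds; try lra.
    by do 2!case: ifPn; rewrite -?ltNge => *; lra.
  have := psumr_eq0P G_ge0 GE (i := v) isT.
  rewrite /G WE !AV2 // c1_0 c2V' // !add0r.
  have x_le1 := share_le1 x v; have x_gt0 := blocks_share_gt0 bl vV'.
  by rewrite !PAV_utility_le1; lra.
by apply: SJR_swap bl V'half _ c1v; rewrite WE !inE eqxx.
Qed.

(** For k = 1 the group V' is the whole electorate, so W scores 0 while {x} scores more. *)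
Lemma PAV1_not_blocks W (V' : {set voter E}) x :
  PAV_committee 1 W -> ~~ blocks 1 W V' x.
Proof.
case=> /eqP/cards1P[c ->] maxW; apply/negP => bl.
have [nV' _ WV'] := blocksP _ _ _ _ bl.
have V'T v : v \in V'.
  have /eqP -> : V' == setT by rewrite eqEcard subsetT cardsT -[#|V'|]muln1.
  by rewrite inE.
have := maxW [set x]; rewrite cards1 => /(_ erefl).
apply/negP; rewrite -ltNge.
rewrite /PAV_score [ltLHS]big1 => [|v _]; last first.
  by rewrite AV1 WV' ?inE // PAV_utility_le1 ?lexx ?ler01.
have pos v : 0 < PAV_utility (AV [set x] v).
  have := blocks_share_gt0 bl (V'T v) => xv.
  by rewrite AV1 PAV_utility_le1 // share_le1 ltW.
have /card_gt0P[v _] := voter_gt0 E.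
by rewrite (bigD1 v) //= ltr_pwDl // sumr_ge0 // => u _; apply/ltW.
Qed.

(** * RAV for d <= 2 and k <= 2 *)

Lemma RAV_score0 c : RAV_score set0 c = \sum_v share c v.
Proof. by apply: eq_bigr => v _; rewrite AV0 addr0 divr1 mul1r. Qed.

Lemma RAV_score1 c x :
  RAV_score [set c] x = \sum_v share x v / (1 + share c v).
Proof. by apply: eq_bigr => v _; rewrite AV1 mul1r mulrC. Qed.

Lemma RAV_stage_inv W n :
  RAV_stage W -> #|W| = n.+1 ->
  exists W0 c, [/\ W = c |: W0, RAV_stage W0, #|W0| = n, c \notin W0
    & forall c', c' \notin W0 -> RAV_score W0 c' <= RAV_score W0 c].
Proof.
case=> [|W0 c stW0 cW0 maxc]; first by rewrite cards0.
by rewrite cardsU1 cW0 => -[W0n]; exists W0, c.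
Qed.

Lemma RAV_swap W (V' : {set voter E}) x :
  (d <= 2)%N -> RAV_committee 2 W -> blocks 2 W V' x ->
  d = 2 /\ exists W', RAV_committee 2 W' /\ SJR 2 W'.
Proof.
move=> d_le2 [stW W2] bl.
have [W1 [c2 [WE stW1 W1_1 c2W1 maxc2]]] := RAV_stage_inv stW W2.
have [W0 [c1 [W1E _ /cards0_eq W00 _ maxc1]]] := RAV_stage_inv stW1 W1_1.
rewrite W00 setU0 in W1E; rewrite {}W00 in maxc1.
rewrite {}W1E in WE stW1 maxc2 c2W1 W1_1.
have := blocks_notin bl; rewrite WE !inE negb_or => /andP[xc2 xc1].
have [_ xV' WV'] := blocksP _ _ _ _ bl.
have c1V' v : v \in V' -> share c1 v = 0.
  by apply: WV'; rewrite WE !inE eqxx orbT.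
have c2V' v : v \in V' -> share c2 v = 0.
  by apply: WV'; rewrite WE !inE eqxx.
have := maxc1 c2; have := maxc1 x; have := maxc2 x.
rewrite !RAV_score0 !RAV_score1 !inE => /(_ xc1) le_x2 /(_ isT) le_x1.
move=> /(_ isT) le_21.
(* The greedy choices of c2 over x and of c1 over c2, with weights 1 and 1/2. *)
pose F v := share c2 v / (1 + share c1 v) - share x v / (1 + share c1 v)
            + (share c1 v - share c2 v) / 2.
have FE : \sum_v F v
    = \sum_v share c2 v / (1 + share c1 v)
      - \sum_v share x v / (1 + share c1 v)
      + (\sum_v share c1 v - \sum_v share c2 v) / 2.
  by rewrite -!sumrB mulr_suml -big_split.
have [v vV'|v vV'||d2 V'half F0] := blocks_tie d_le2 bl (F := F).
- by have := xV' v vV'; rewrite /F c1V' // c2V' // addr0 !divr1; lra.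
(* Without the term of x, and with y and t the shares of c1 and c2, the bound amounts to t (1 - y) /
   (1 + y) <= 1 - y. *)
- rewrite /F -mulrBl.
  have := share_ge0 x v; have := share_le1 c1 v; have := share_ge0 c1 v.
  have := share_le1 c2 v; have := share_ge0 c2 v.
  move: (share x v) (share c1 v) (share c2 v) => z y t *.
  by rewrite -lerBrDr ler_pdivrMr; nra.
- rewrite FE; lra.
split=> //.
(* Otherwise x would have beaten c1 in the first round. *)
have [v c1v] : exists v, 0 < share c1 v.
  apply/existsP; apply: contraTT isT => /existsPn c1_0.
  have /card_gt0P[v vV'] := blocks_gt0 bl.
  have := le_x1; rewrite (bigD1 v) //=.
  have : \sum_u share c1 u <= 0.
    by rewrite sumr_le0 // => u _; rewrite leNgt c1_0.
  have : 0 <= \sum_(u | u != v) share x u.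
    by rewrite sumr_ge0 // => u _; rewrite share_ge0.
  by have := blocks_share_gt0 bl vV'; lra.
exists (x |: [set c1]); split; last first.
  by rewrite setUC; apply: SJR_swap bl V'half _ c1v; rewrite WE !inE eqxx orbT.
split; last by rewrite cards2 xc1.
(* The sum of F combines two nonnegative score differences and is zero, so x ties with c2 in the
   second round. *)
apply: RAV_add; rewrite ?inE // => c' c'c1.
apply: le_trans (maxc2 _ c'c1) _; rewrite !RAV_score1; lra.
Qed.

Lemma RAV1_not_blocks W (V' : {set voter E}) x :
  RAV_committee 1 W -> ~~ blocks 1 W V' x.
Proof.
case=> stW W1; apply/negP => bl.
have [W0 [c [WE _ /cards0_eq -> _ maxc]]] := RAV_stage_inv stW W1.
have [nV' _ WV'] := blocksP _ _ _ _ bl.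
have V'T v : v \in V'.
  have /eqP -> : V' == setT by rewrite eqEcard subsetT cardsT -[#|V'|]muln1.
  by rewrite inE.
have := maxc x; rewrite !inE !RAV_score0 => /(_ isT).
apply/negP; rewrite -ltNge.
rewrite [ltLHS]big1 => [|v _]; last by rewrite WV' // WE !inE eqxx.
have /card_gt0P[v _] := voter_gt0 E.
rewrite (bigD1 v) //= ltr_pwDl ?(blocks_share_gt0 bl) //.
by rewrite sumr_ge0 // => u _; apply: share_ge0.
Qed.

(** The conclusion common to both rules, with R k the outcomes for size k: a blocked outcome can
    occur only for k = d = 2, and there the swap gives a good one. *)
Lemma SJR_of_swap (R : nat -> {set cand E} -> Prop) k W :
  (0 < k <= 2)%N -> (d <= 2)%N ->
  (forall W (V' : {set voter E}) x, R 1%N W -> ~~ blocks 1 W V' x) ->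
  (forall W (V' : {set voter E}) x, R 2 W -> blocks 2 W V' x ->
     d = 2 /\ exists W', R 2 W' /\ SJR 2 W') ->
  R k W ->
  (exists W', R k W' /\ SJR k W') /\ (~ (k = 2 /\ d = 2) -> SJR k W).
Proof.
case: k => [|[|[|//]]] //= _ d_le2 R1 R2 RW.
  have W_SJR : SJR 1 W by apply: SJR_of_not_blocks => // V' x; exact: R1.
  by split=> //; exists W.
have [/existsP[V' /existsP[x bl]]|nbl] :=
  boolP [exists V', exists x, blocks 2 W V' x].
  by have [d2 ?] := R2 _ _ _ RW bl; split=> // -[].
have W_SJR : SJR 2 W.
  apply: SJR_of_not_blocks => // V' x.
  by apply: contra nbl => bl; apply/existsP; exists V'; apply/existsP; exists x.
by split=> //; exists W.
Qed.

Lemma PAV_SJR k W :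
  (0 < k <= 2)%N -> (d <= 2)%N -> PAV_committee k W ->
  (exists W', PAV_committee k W' /\ SJR k W') /\
  (~ (k = 2 /\ d = 2) -> SJR k W).
Proof.
move=> k12 d_le2.
apply: (SJR_of_swap (R := fun k W => PAV_committee k W)) => //.
  exact: PAV1_not_blocks.
by move=> W0 V' x; apply: PAV_swap.
Qed.

Lemma RAV_SJR k W :
  (0 < k <= 2)%N -> (d <= 2)%N -> RAV_committee k W ->
  (exists W', RAV_committee k W' /\ SJR k W') /\
  (~ (k = 2 /\ d = 2) -> SJR k W).
Proof.
move=> k12 d_le2.
apply: (SJR_of_swap (R := fun k W => RAV_committee k W)) => //.
  exact: RAV1_not_blocks.
by move=> W0 V' x; apply: RAV_swap.
Qed.

End Election.

(** * The counterexample for k < (k - 1) d *)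

Section Counterexample.
Local Open Scope ring_scope.
Variables (k d : nat).
Hypotheses (k_gt0 : (0 < k)%N) (d_gt0 : (0 < d)%N).

Let v0 : 'I_k := Ordinal k_gt0.
Let j0 : 'I_d := Ordinal d_gt0.

(* Voter [v0] approves of [None] on one dimension only, whereas every other
   voter approves of all the attributes of each of the k candidates [Some i]. *)
Let cex_attr (c : option 'I_k) (j : 'I_d) : bool := c == None.
Let cex_appr (v : 'I_k) (j : 'I_d) : {set bool} :=
  if v == v0 then (if j == j0 then [set true] else set0) else [set false].

Let cex_voter_gt0 : (0 < #|'I_k|)%N. Proof. by rewrite card_ord. Qed.

Let cex_dom_attained (j : 'I_d) (b : bool) : exists c, cex_attr c j = b.
Proof. by case: b; [exists None | exists (Some v0)]. Qed.

Let cex : election d := Election cex_appr cex_voter_gt0 cex_dom_attained.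
Implicit Types (W : {set cand cex}) (c : cand cex) (v : voter cex).

Let shareE c v : share c v =
  if v == v0 then (if c == None then d%:R^-1 else 0) else (c != None)%:R.
Proof.
rewrite /share /= /cex_appr /cex_attr; case: ifP => _; case: eqP => _.
- rewrite (_ : [set _ | _] = [set j0]) ?cards1 ?mul1r //.
  by apply/setP => j; rewrite !inE; case: ifP; rewrite ?inE.
- rewrite (_ : [set _ | _] = set0) ?cards0 ?mul0r //.
  by apply/setP => j; rewrite !inE; case: ifP; rewrite ?inE.
- rewrite (_ : [set _ | _] = set0) ?cards0 ?mul0r //.
  by apply/setP => j; rewrite !inE.
- rewrite (_ : [set _ | _] = setT) ?cardsT ?card_ord.
    by rewrite mulfV // pnatr_eq0 -lt0n.
  by apply/setP => j; rewrite !inE.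
Qed.

Let AV_v0 W : AV W v0 = (if None \in W then d%:R^-1 else 0).
Proof.
rewrite /AV; under eq_bigr do rewrite shareE eqxx.
by rewrite -big_mkcondr /= big_mkcond /= (bigD1 None) //= eqxx andbT big1 ?addr0
  => // c; case: c => // c _; rewrite andbF.
Qed.

Let AV_not_v0 W v : v != v0 -> AV W v = #|W :\ None|%:R.
Proof.
move=> vv0; rewrite /AV; under eq_bigr do rewrite shareE (negPf vv0).
rewrite -natr_sum -sum1_card; congr _%:R.
rewrite [LHS]big_mkcond [RHS]big_mkcond /=.
by apply: eq_bigr => c _; rewrite !inE; case: (c == None); case: (c \in W).
Qed.

Let sum_not_v0 (a : rat) : \sum_(v | v != v0) a = (k.-1)%:R * a.
Proof.
rewrite sumr_const mulr_natl; congr (_ *+ _).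
by have := cardC1 v0; rewrite card_ord => <-; apply: eq_card.
Qed.

Let not_SJR W : None \notin W -> ~ SJR k W.
Proof.
move=> NW /(_ [set v0]) SJRW; case: SJRW.
- by rewrite cards1 /= card_ord mulfV // pnatr_eq0 -lt0n.
- exists j0; apply/set0Pn; exists true.
  by rewrite big_set1 /= /cex_appr !eqxx inE.
move=> j /set0Pn[b]; rewrite big_set1 inE /= /cex_appr eqxx.
case: ifP => _; rewrite ?inE //= => /andP[/eqP ->] /imsetP[c cW] /eqP.
by rewrite eq_sym eqb_id => /eqP cN; rewrite cN (negPf NW) in cW.
Qed.

Hypothesis kd : (k < k.-1 * d)%N.

Let kd_rat : d%:R^-1 < (k.-1)%:R / k%:R :> rat.
Proof.
rewrite ltr_pdivlMr ?ltr0n // mulrC ltr_pdivrMr ?ltr0n //.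
by rewrite -natrM ltr_nat.
Qed.

Let RAV_None W : RAV_stage W -> (#|W| <= k)%N -> None \notin W.
Proof.
elim=> [|W0 c stW0 IHW0 cW0 maxc]; first by rewrite inE.
rewrite cardsU1 cW0 => W0k; have {}IHW0 := IHW0 (ltnW W0k).
rewrite !inE negb_or IHW0 andbT; apply/negP => /eqP cN.
(* Before the last stage fewer than k candidates are chosen, so some [Some i] still competes with
   [None]. *)
have [i iW0] : exists i, Some i \notin W0.
  apply/existsP; apply: contraLR W0k => /existsPn W0i.
  rewrite -ltnNge add1n ltnS.
  have <- : #|[set Some i | i in 'I_k]| = k.
    by rewrite card_imset ?card_ord //; apply: Some_inj.
  by apply/subset_leq_card/subsetP => _ /imsetP[i _ ->]; apply/negPn/W0i.
have := maxc _ iW0; rewrite -cN.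
apply/negP; rewrite -ltNge /RAV_score.
rewrite [ltLHS](bigD1 v0) //= [ltRHS](bigD1 v0) //=.
rewrite !shareE eqxx /= AV_v0 (negPf IHW0) addr0 divr1 mul1r mulr0 add0r.
rewrite big1 ?addr0 => [|v vv0]; last by rewrite shareE (negPf vv0) mulr0.
rewrite (eq_bigr (fun=> 1 / (1 + #|W0 :\ None|%:R))); last first.
  by move=> v vv0; rewrite shareE (negPf vv0) mulr1 AV_not_v0.
(* As 1 + |W0| <= k, each of the k - 1 voters other than v0 contributes at least 1/k to the score of
   [Some i]. *)
rewrite sum_not_v0 mul1r; apply: lt_le_trans kd_rat _.
rewrite ler_wpM2l // nat1r lef_pV2 ?posrE ?ltr0n // ler_nat.
apply: leq_trans W0k; rewrite add1n ltnS.
by rewrite subset_leq_card // subD1set.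
Qed.

Let PAV_None W : PAV_committee k W -> None \notin W.
Proof.
case=> Wk maxW; apply/negP => NW.
(* The competitor consists of all k candidates [Some i]. It costs v0 only 1/d and raises each other
   voter from k - 1 to k, a gain of 1/k. *)
pose W0 : {set cand cex} := setT :\ None.
have W0k : #|W0| = k.
  have := cardsD1 (None : cand cex) setT.
  by rewrite inE cardsT card_option card_ord /= => -[].
have := maxW W0 W0k; apply/negP; rewrite -ltNge /PAV_score.
rewrite [ltLHS](bigD1 v0) //= [ltRHS](bigD1 v0) //= !AV_v0 NW !inE /=.
under eq_bigr => v vv0 do rewrite AV_not_v0 //.
rewrite sum_not_v0.
under eq_bigr => v vv0 do rewrite AV_not_v0 //.
rewrite sum_not_v0.
have -> : #|W :\ None| = k.-1.
  by have /(congr1 predn) := cardsD1 None W; rewrite NW Wk => ->.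
have -> : #|W0 :\ None| = k.
  by have := cardsD1 None W0; rewrite !inE W0k.
rewrite !PAV_utility_nat prednK // (big_nat_recr k) //= !PAV_utility_le1.
- by rewrite add0r mulrDr addrC ltrD2l mul1r kd_rat.
- by rewrite lexx ler01.
- by rewrite invr_ge0 ler0n invf_le1 ?ler1n ?ltr0n.
Qed.

Lemma PAV_not_SJR (F : rule d) : PAV_rule k F -> ~ satisfies_SJR k F.
Proof.
have k_le : (k <= #|cand cex|)%N by rewrite card_option card_ord.
by move=> /(_ cex k_le)/PAV_None NF /(_ cex k_le); apply: not_SJR.
Qed.

Lemma RAV_not_SJR (F : rule d) : RAV_rule k F -> ~ satisfies_SJR k F.
Proof.
have k_le : (k <= #|cand cex|)%N by rewrite card_option card_ord.
move=> /(_ cex k_le)[stF Fk] /(_ cex k_le); apply: not_SJR.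
by rewrite RAV_None ?Fk.
Qed.

End Counterexample.

(** * From outcomes to rules, and the theorem *)

Lemma rule_exists (k d : nat)
    (P : forall E : election d, {set cand E} -> Prop) :
  (forall E : election d, k <= #|cand E| -> exists W, P E W) ->
  exists F : rule d, forall E : election d, k <= #|cand E| -> P E (F E).
Proof.
(* With the size condition inside the existential, choice applies to every election; those with too
   few candidates admit the empty set. *)
move=> exW; have {}exW (E : election d) : exists W, k <= #|cand E| -> P E W.
  have [/exW[W PW]|_] := boolP (k <= #|cand E|); first by exists W.
  by exists set0.
exists (fun E => proj1_sig (constructive_indefinite_description _ (exW E))).
by move=> E; case: constructive_indefinite_description.
Qed.

Theorem lemma4 (k d : nat) (k_gt0 : 0 < k) (d_gt0 : 0 < d) :
  ((3 <= k /\ 2 <= d) \/ (3 <= d /\ 2 <= k) ->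
     (forall F : rule d, PAV_rule k F -> ~ satisfies_SJR k F) /\
     (forall F : rule d, RAV_rule k F -> ~ satisfies_SJR k F)) /\
  (k <= 2 /\ d <= 2 ->
     (exists F : rule d, PAV_rule k F /\ satisfies_SJR k F) /\
     (exists F : rule d, RAV_rule k F /\ satisfies_SJR k F) /\
     (* a tie can be broken against SJR only for k = d = 2 *)
     (~ (k = 2 /\ d = 2) ->
        (forall F : rule d, PAV_rule k F -> satisfies_SJR k F) /\
        (forall F : rule d, RAV_rule k F -> satisfies_SJR k F))).
Proof.
split=> [kd|[k_le2 d_le2]].
  (* Both cases reduce to this: 2 (k - 1) > k for k >= 3, and 3 (k - 1) > k for k >= 2. *)
  have {}kd : k < k.-1 * d by case: k k_gt0 kd => // n _; nia.
  by split=> F; [apply: PAV_not_SJR | apply: RAV_not_SJR].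
have k12 : 0 < k <= 2 by rewrite k_gt0.
split; last split.
- have [E k_le|F FP] :=
    @rule_exists k d (fun E W => PAV_committee k W /\ SJR k W).
    have [W RW] := PAV_committee_exists k_le.
    by have [] := PAV_SJR d_gt0 k12 d_le2 RW.
  by exists F; split=> E /FP[].
- have [E k_le|F FP] :=
    @rule_exists k d (fun E W => RAV_committee k W /\ SJR k W).
    have [W RW] := RAV_committee_exists k_le.
    by have [] := RAV_SJR d_gt0 k12 d_le2 RW.
  by exists F; split=> E /FP[].
move=> kd; split=> F FR E k_le.
- by have [_] := PAV_SJR d_gt0 k12 d_le2 (FR E k_le); apply.
- by have [_] := RAV_SJR d_gt0 k12 d_le2 (FR E k_le); apply.
Qed.
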